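(* Let $\mathbb{F}$ be an arbitrary field, let $p_0,p_1$ be nonzero elements of $\mathbb{F}$, let $a_0,a_1\in\mathbb{F}$, and let the sequence $\{W_k\}_{k\in\mathbb{Z}}=\{W_k(a_0,a_1;p_0,p_1)\}_{k\in\mathbb{Z}}$ be defined by the relation $W_{k+2}=p_0W_{k+1}+p_1W_k$ with $W_0=a_0$, $W_1=a_1$. Let $s$ be an integer such that $W_s=0$, let $n$ be a nonnegative integer, and let $d_0,d_1,\dots,d_n$ be integers such that $W_{d_i-d_j+s}\neq 0$ for all $i\neq j$. Then for all integers $k,x$, $$W_{k+x}^n=\sum_{i=0}^{n}W_{k+d_i}^n\prod_{\substack{j=0\\ j\neq i}}^{n}\frac{W_{x-d_j+s}}{W_{d_i-d_j+s}}.$$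
   Context: The sequence $W_k$ is indexed by all integers: since $p_1\neq 0$, the recurrence $W_{k+2}=p_0W_{k+1}+p_1W_k$ determines $W_k$ uniquely for negative $k$ as well. Empty products and zeroth powers equal $1$. *)

(* Defs.v *)
From HB Require Import structures.
From mathcomp Require Import all_boot all_order all_algebra.
Set Implicit Arguments.
Unset Strict Implicit.
Unset Printing Implicit Defensive.

(* Main.v *)
Require Import Defs.
From HB Require Import structures.
From mathcomp Require Import all_boot all_order all_algebra.
From mathcomp Require Import ring.
Set Implicit Arguments.
Unset Strict Implicit.
Unset Printing Implicit Defensive.
Import GRing.Theory.
Local Open Scope ring_scope.

(** The identity is Lagrange interpolation for the binary form of degree [n]
    obtained as the [n]-th power of a linear form.

    The solutions of the recurrence form a space of dimension two, so an integer
    [x] can be thought of as a point of the plane, evaluation at [x], on which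
    [x |-> W (k + x)] is a linear form.  Up to a factor, [W (x - y + s)] is
    the determinant of the points [x] and [y]: it solves the recurrence in [x]
    and vanishes at [x = y].  The factor [(- p1) ^ y] makes it antisymmetric;
    call the result [[x, y]] ([bracket]).  Since this factor cancels from the
    quotients, the claim is

      [f x ^+ n = \sum_i f (d i) ^+ n * \prod_(j != i) [x, d j] / [d i, d j]]

    for [f x = W (k + x)].  The only fact about the plane that it requires is
    the linear dependence between three of its points,

      [f a * [b, c] + f b * [c, a] + f c * [a, b] = 0],

    which is [bracket_three_term], and [homogeneous_lagrange_pow] derives the
    interpolation formula from it by induction on the number of nodes.  This
    avoids any choice of coordinates, and also any division by a value of [W]
    other than those in the statement. *)

(** * Homogeneous Lagrange interpolation *)

(** When the node [c = d ord_max] is added, the three-term relation splits the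
    term of each older node [d i] in two: [f x] times the term of the formula
    for the older nodes, which sum to [f x ^+ n.+1], and a rest proportional to
    [f c].  The rests cancel the term of the node [c] itself, because of the
    formula for the older nodes evaluated at [x = c]. *)
Lemma homogeneous_lagrange_pow (F : fieldType) (T : Type) (f : T -> F)
    (h : T -> T -> F) (h_anti : forall a b, h b a = - h a b)
    (h_three : forall a b c, f a * h b c + f b * h c a + f c * h a b = 0)
    (n : nat) (d : 'I_n.+1 -> T)
    (h_d : forall i j, i != j -> h (d i) (d j) != 0) (x : T) :
  f x ^+ n = \sum_(i < n.+1) f (d i) ^+ n *
               \prod_(j < n.+1 | j != i) (h x (d j) / h (d i) (d j)).
Proof.
elim: n d h_d x => [|n IHn] d h_d x.
  rewrite big_ord1 !expr0 mul1r big_pred0 // => j.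
  by rewrite !ord1 eqxx.
pose e (i : 'I_n.+1) := d (widen_ord (leqnSn n.+1) i).
pose c := d ord_max.
have wid_inj (i j : 'I_n.+1) :
  (widen_ord (leqnSn n.+1) i == widen_ord (leqnSn n.+1) j) = (i == j) by [].
have wid_max (i : 'I_n.+1) : (widen_ord (leqnSn n.+1) i == ord_max) = false.
  by apply/negbTE; rewrite -val_eqE /= neq_ltn ltn_ord.
have h_e i j : i != j -> h (e i) (e j) != 0.
  by move=> ij; apply: h_d; rewrite wid_inj.
have h_ec i : h (e i) c != 0 by apply: h_d; rewrite wid_max.
have h_ce i : h c (e i) != 0 by rewrite h_anti oppr_eq0.
have IHe := IHn e h_e.
pose P y i := \prod_(j < n.+1 | j != i) (h y (e j) / h (e i) (e j)).
pose N y := \prod_(j < n.+1) h y (e j).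
have N_neq0 : N c != 0 by apply/prodf_neq0.
rewrite big_ord_recr /= -/c.
have -> : \prod_(j < n.+2 | j != ord_max) (h x (d j) / h c (d j)) = N x / N c.
  rewrite big_mkcond big_ord_recr /= eqxx mulr1 /N -prodf_div.
  by apply: eq_bigr => i _; rewrite wid_max.
(* The rest of the old term [i], as a multiple of [P c i]: the products
   [P x i] and [P c i] have the same denominators. *)
have rest i : P x i * h x (e i) = P c i * h c (e i) * (N x / N c).
  have P_N y : P y i * h y (e i) = N y / \prod_(j | j != i) h (e i) (e j).
    by rewrite /P /N prodf_div [\prod_(j < n.+1) h y _](bigD1 i) //= mulrAC
      [h y _ * _]mulrC.
  by rewrite !P_N; field; rewrite N_neq0; apply/prodf_neq0 => j ji;
    apply: h_e; rewrite eq_sym.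
have old i : f (e i) ^+ n.+1 *
    \prod_(j < n.+2 | j != widen_ord (leqnSn n.+1) i)
       (h x (d j) / h (e i) (d j)) =
    f x * (f (e i) ^+ n * P x i)
    - f c * (N x / N c) * (f (e i) ^+ n * P c i).
  rewrite big_mkcond big_ord_recr /= [ord_max == _]eq_sym wid_max /= -/c.
  have -> : \prod_(j < n.+1)
      (if widen_ord (leqnSn n.+1) j != widen_ord (leqnSn n.+1) i
       then h x (d (widen_ord (leqnSn n.+1) j)) /
            h (e i) (d (widen_ord (leqnSn n.+1) j)) else 1) = P x i.
    by rewrite /P [RHS]big_mkcond.
  have Plucker : f (e i) * h x c = f x * h (e i) c + f c * h x (e i).
    apply/eqP; rewrite -subr_eq0; apply/eqP.
    rewrite -[RHS](h_three (e i) x c) [h c (e i)]h_anti [h (e i) x]h_anti.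
    by ring.
  have -> : f (e i) ^+ n.+1 * (P x i * (h x c / h (e i) c)) =
            f (e i) ^+ n * P x i * (f (e i) * h x c) / h (e i) c.
    by rewrite exprS; ring.
  rewrite Plucker.
  have -> : f (e i) ^+ n * P x i * (f x * h (e i) c + f c * h x (e i))
            / h (e i) c =
            f x * (f (e i) ^+ n * P x i)
            + f c * f (e i) ^+ n * (P x i * h x (e i)) / h (e i) c.
    by field.
  by rewrite rest [h c (e i)]h_anti; field; rewrite h_ec N_neq0.
rewrite (eq_bigr _ (fun i _ => old i)) big_split /= sumrN -!mulr_sumr.
by rewrite -!IHe !exprS; ring.
Qed.

(** * Second-order recurrences over the integers *)

Definition solves_rec (F : fieldType) (p0 p1 : F) (u : int -> F) :=
  forall k : int, u (k + 2) = p0 * u (k + 1) + p1 * u k.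

Lemma solves_rec_shift (F : fieldType) (p0 p1 : F) u (m : int) :
  solves_rec p0 p1 u -> solves_rec p0 p1 (fun k => u (k + m)).
Proof. by move=> u_rec k; rewrite ![k + _ + m]addrAC u_rec. Qed.

Lemma solves_rec_scale (F : fieldType) (p0 p1 c : F) u :
  solves_rec p0 p1 u -> solves_rec p0 p1 (fun k => c * u k).
Proof. by move=> u_rec k; rewrite u_rec; ring. Qed.

Lemma solves_rec_add (F : fieldType) (p0 p1 : F) u v :
  solves_rec p0 p1 u -> solves_rec p0 p1 v ->
  solves_rec p0 p1 (fun k => u k + v k).
Proof. by move=> u_rec v_rec k; rewrite u_rec v_rec; ring. Qed.

(** Since [p1] is invertible, the recurrence can be run in both directions. *)
Lemma solves_rec_eq0 (F : fieldType) (p0 p1 : F) (p1_neq0 : p1 != 0) u (c : int) :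
  solves_rec p0 p1 u -> u c = 0 -> u (c + 1) = 0 -> forall k, u k = 0.
Proof.
move=> u_rec u0 u1 k.
suff H m : u (c + m) = 0 /\ u (c + m + 1) = 0.
  by case: (H (k - c)) => + _; rewrite [c + _]addrC subrK.
elim/int_ind: m => [|m [IH0 IH1]|m [IH0 IH1]]; first by rewrite addr0.
- have -> : c + m.+1%:Z = c + m%:Z + 1 by rewrite intS; ring.
  split=> //; have -> : c + m%:Z + 1 + 1 = c + m%:Z + 2 by ring.
  by rewrite u_rec IH0 IH1 !mulr0 addr0.
- have e1 : c - m.+1%:Z + 1 = c - m%:Z by rewrite intS; ring.
  have e2 : c - m.+1%:Z + 2 = c - m%:Z + 1 by rewrite intS; ring.
  rewrite e1; split=> //.
  have := u_rec (c - m.+1%:Z).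
  rewrite e1 e2 IH0 IH1 mulr0 add0r => /esym/eqP.
  by rewrite mulf_eq0 (negbTE p1_neq0) => /eqP.
Qed.

(** Time reversal maps a solution to a solution once it is twisted by the powers
    of [- p1], the determinant of the companion matrix. *)
Lemma solves_rec_rev (F : fieldType) (p0 p1 : F) (p1_neq0 : p1 != 0) u (s : int) :
  solves_rec p0 p1 u -> solves_rec p0 p1 (fun m => (- p1) ^ m * u (s - m)).
Proof.
move=> u_rec m.
have q0 : - p1 != 0 by rewrite oppr_eq0.
have := u_rec (s - (m + 2)).
have -> : s - (m + 2) + 2 = s - m by ring.
have -> : s - (m + 2) + 1 = s - (m + 1) by ring.
have -> : (- p1) ^ (m + 2) = (- p1) ^ m * (- p1) * (- p1).
  by rewrite expfzDr // -mulrA.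
rewrite expfzDr // expr1z => ->.
by ring.
Qed.

Lemma rec_antisym (F : fieldType) (p0 p1 : F) (p1_neq0 : p1 != 0) u (s : int) :
  solves_rec p0 p1 u -> u s = 0 ->
  forall m, (- p1) ^ m * u (s - m) = - u (s + m).
Proof.
move=> u_rec us m; apply/eqP; rewrite -addr_eq0 [s + m]addrC; apply/eqP.
apply: (solves_rec_eq0 (c := 0) p1_neq0 (solves_rec_add
  (solves_rec_rev p1_neq0 s u_rec) (solves_rec_shift s u_rec))).
  by rewrite subr0 add0r us mulr0 addr0.
rewrite add0r expr1z.
have := u_rec (s - 1); have -> : s - 1 + 2 = 1 + s by ring.
by rewrite subrK us => ->; ring.
Qed.

(** * The bracket of two integers *)

(** If [u s = 0], this is a constant multiple of the determinant
    [v x * v' y - v' x * v y] for a basis [(v, v')] of the space of solutions. *)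
Definition bracket (F : fieldType) (p1 : F) (u : int -> F) (s x y : int) : F :=
  (- p1) ^ y * u (x - y + s).

Lemma bracketN (F : fieldType) (p0 p1 : F) (p1_neq0 : p1 != 0) u (s : int) :
  solves_rec p0 p1 u -> u s = 0 ->
  forall x y, bracket p1 u s y x = - bracket p1 u s x y.
Proof.
move=> u_rec us x y; have q0 : - p1 != 0 by rewrite oppr_eq0.
rewrite /bracket -mulrN [x - y + s]addrC -(rec_antisym p1_neq0 u_rec us).
rewrite mulrA -expfzDr //.
by congr (_ ^ _ * u _); ring.
Qed.

Lemma solves_rec_bracketl (F : fieldType) (p0 p1 : F) u (s y : int) :
  solves_rec p0 p1 u -> solves_rec p0 p1 (fun x => bracket p1 u s x y).
Proof.
move=> u_rec; apply: solves_rec_scale.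
exact: solves_rec_shift (- y) (solves_rec_shift s u_rec).
Qed.

(** The left-hand side solves the recurrence in each of [a] and [b], so it is
    enough that it vanishes for [a] and [b] in [{c, c + 1}], where it does so
    because it is alternating. *)
Lemma bracket_three_term (F : fieldType) (p0 p1 : F) (p1_neq0 : p1 != 0)
    u v (s : int) :
  solves_rec p0 p1 u -> u s = 0 -> solves_rec p0 p1 v ->
  forall a b c, v a * bracket p1 u s b c + v b * bracket p1 u s c a
                + v c * bracket p1 u s a b = 0.
Proof.
move=> u_rec us v_rec a b c.
have hN := bracketN p1_neq0 u_rec us.
have h0 x : bracket p1 u s x x = 0 by rewrite /bracket subrr add0r us mulr0.
have h_rec y := solves_rec_bracketl s y u_rec.
pose G a b := bracket p1 u s b c * v a + - v b * bracket p1 u s a c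
              + v c * bracket p1 u s a b.
suff G0 : G a b = 0.
  by rewrite -[RHS]G0 /G [bracket p1 u s c a]hN; ring.
have G_rec y : solves_rec p0 p1 (G^~ y).
  by apply: solves_rec_add; [apply: solves_rec_add|];
    apply: solves_rec_scale.
have GN x y : G y x = - G x y.
  by rewrite /G [bracket p1 u s y x]hN; ring.
have Gc y : G c y = 0.
  by rewrite /G h0 [bracket p1 u s c y]hN; ring.
apply: (solves_rec_eq0 p1_neq0 (G_rec b) (Gc b)).
rewrite GN; apply/eqP; rewrite oppr_eq0; apply/eqP.
apply: (solves_rec_eq0 p1_neq0 (G_rec (c + 1)) (Gc _)).
by rewrite /G h0; ring.
Qed.

(** * The interpolation formula *)

Theorem corollary1 (F : fieldType) (p0 p1 : F) (p0_neq0 : p0 != 0)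
    (p1_neq0 : p1 != 0) (a0 a1 : F) (W : int -> F)
    (W_rec : forall k : int, W (k + 2) = p0 * W (k + 1) + p1 * W k)
    (W_0 : W 0 = a0) (W_1 : W 1 = a1)
    (s : int) (W_s : W s = 0) (n : nat) (d : 'I_n.+1 -> int)
    (W_d : forall i j : 'I_n.+1, i != j -> W (d i - d j + s) != 0) :
  forall k x : int,
    W (k + x) ^+ n =
    \sum_(i < n.+1)
      W (k + d i) ^+ n *
      \prod_(j < n.+1 | j != i) (W (x - d j + s) / W (d i - d j + s)).
Proof.
move=> k x.
have q0 m : (- p1) ^ m != 0 by rewrite expfz_neq0 // oppr_eq0.
have Wk_rec : solves_rec p0 p1 (fun x => W (k + x)).
  by move=> m; have := W_rec (k + m); rewrite -!addrA.
have h_d i j : i != j -> bracket p1 W s (d i) (d j) != 0.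
  by move=> ij; rewrite mulf_neq0 // W_d.
rewrite (homogeneous_lagrange_pow (bracketN p1_neq0 W_rec W_s)
  (bracket_three_term p1_neq0 W_rec W_s Wk_rec) h_d).
apply: eq_bigr => i _; congr (_ * _); apply: eq_bigr => j ji.
by rewrite /bracket -mulf_div divff // mul1r.
Qed.
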